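(* Let $\lambda\in\mathbb{R}$ and let $\epsilon$ be an admissible privacy level for $\lambda$ (i.e. $\epsilon>0$, and additionally $\epsilon<-[\lambda(\lambda+1)]^{-1}$ if $\lambda(\lambda+1)<0$). Let $M(w,D)=W(D)+\mathbf{Y}$ be an additive mechanism, $\mathbf{Y}=(Y_1,\dots,Y_m)$ independent of the data. If the $Y_i$ are i.i.d. $N(0,\sigma^2)$, then the choice $$\sigma^2=\sigma^2_{\lambda,\epsilon}=\begin{cases}(\Delta_{L_2}W)^2\cdot\dfrac{\lambda(\lambda+1)}{2\log(1+\lambda(\lambda+1)\epsilon)} & \text{if }\lambda(\lambda+1)\ne0,\\[2mm] (\Delta_{L_2}W)^2\cdot\dfrac{1}{2\epsilon}&\text{otherwise}\end{cases}$$ renders the mechanism $(\lambda,\epsilon)$-PDP. If the $Y_i$ are i.i.d. $Lap(0,b)$, then the choice $$b=b_{\lambda,\epsilon}=\begin{cases}\max\left\{\dfrac{\mathrm{sign}(\lambda)(\lambda+1)\Delta_{L_1}W}{\log(\lambda(\lambda+1)\epsilon+1)},\ \dfrac{\mathrm{sign}(\lambda+1)\lambda\,\Delta_{L_1}W}{\log(\lambda(\lambda+1)\epsilon+1)}\right\}&\text{if }\lambda(\lambda+1)\neq0,\\[2mm] \dfrac{\Delta_{L_1}W}{\epsilon}&\text{otherwise}\end{cases}$$ renders the mechanism $(\lambda,\epsilon)$-PDP. Furthermore, choosing $\lambda=-\frac12$ and replacing $\epsilon$ by $2\epsilon$ (so that $(-\frac12,2\epsilon)$-PDP is $\epsilon$-HDP),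 one obtains for Gaussian $\mathbf{Y}$ and Laplace $\mathbf{Y}$ respectively $$\sigma^2_{HDP,\epsilon}=\frac{(\Delta_{L_2}W)^2}{8\log\left(\frac{1}{1-0.5\epsilon}\right)},\qquad b_{HDP,\epsilon}=\frac{\Delta_{L_1}W}{2\log\left(\frac{1}{1-0.5\epsilon}\right)}.$$
   Context: Datasets are elements $D=(x_1,\dots,x_n)$ of a database $\mathcal{D}\subset\mathbb{R}^n$; $D,D'$ are adjacent if they differ in exactly one coordinate (Hamming distance $\|D-D'\|_H=1$). A query is a measurable map $W:\mathcal{D}\to\mathbb{R}^m$, $w=W(D)$, with sensitivities $\Delta_{L_r}W=\sup_{\|D-D'\|_H=1}\|W(D)-W(D')\|_r$, $r=1,2$ (assumed finite and positive, so that the noise is well defined). $Lap(0,b)$ has density $\frac{1}{2b}e^{-|y|/b}$. Power divergence: for distributions $P_1,P_2$ on $\mathbb{R}^m$ with densities $p_1,p_2$ and $\lambda\ne-1,0$, $D_\lambda(P_1,P_2)=\frac{1}{\lambda(\lambda+1)}\mathbf{E}_{X\sim p_2}\left[\left(\frac{p_1(X)}{p_2(X)}\right)^{\lambda+1}-1\right]$; $D_0,D_{-1}$ are defined by limits, and $D_0(P_1,P_2)=D_{-1}(P_2,P_1)=KL(P_1,P_2)$. $M$ satisfies $(\lambda,\epsilon)$-PDP (for admissible $\epsilon$) if $D_\lambda(M(w,D),M(w,D'))\le\epsilon$ for all adjacent $D,D'$, where the query in each term is evaluated at the respective dataset. $\epsilon$-HDP means $\int_{\mathbb{R}^m}(\sqrt{p_1}-\sqrt{p_2})^2dx\le\epsilon$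 for the densities $p_1,p_2$ of $M(w,D)$ and $M(w,D')$, for all adjacent $D,D'$; it is equivalent to $(-\frac12,2\epsilon)$-PDP. *)

(* Defs.v *)
From HB Require Import structures.
From mathcomp Require Import all_boot all_order all_algebra.
From mathcomp Require Import all_classical all_reals all_analysis.

Set Implicit Arguments.
Unset Strict Implicit.
Unset Printing Implicit Defensive.

Import Order.TTheory GRing.Theory Num.Def Num.Theory.
Import numFieldNormedType.Exports.

Local Open Scope classical_set_scope.
Local Open Scope ring_scope.

(* R^m with its Borel (= product) sigma-algebra. *)
Notation vec R m := (m.-tuple (measurableTypeR R)).

Section lebesgue_vec.
Context {R : realType}.

Definition vcons (m : nat) (p : measurableTypeR R * vec R m) : vec R m.+1 :=
  [tuple of p.1 :: p.2].

Definition vuncons (m : nat) (t : vec R m.+1) : measurableTypeR R * vec R m :=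
  (tnth t ord0, [tuple of behead t]).

Lemma vconsK m : cancel (@vcons m) (@vuncons m).
Proof. by move=> [x t]; congr pair; apply: val_inj. Qed.

Lemma vunconsK m : cancel (@vuncons m) (@vcons m).
Proof. by move=> t; rewrite /vcons /= [RHS]tuple_eta; apply: val_inj. Qed.

Lemma measurable_vcons m : measurable_fun [set: _] (@vcons m).
Proof. exact: measurable_cons. Qed.

Lemma measurable_vuncons m : measurable_fun [set: _] (@vuncons m).
Proof.
apply: measurable_fun_pair; first exact: measurable_tnth.
exact: measurable_behead.
Qed.

Section step.
Variables (nu : {sigma_finite_measure set (measurableTypeR R) -> \bar R}) (m : nat)
  (mu : {sigma_finite_measure set (vec R m) -> \bar R}).

Definition product_vcons : set (vec R m.+1) -> \bar R :=
  pushforward (nu \x mu)%E (@vcons m).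

Let product_vcons0 : product_vcons set0 = 0%E.
Proof. by rewrite /product_vcons /pushforward preimage_set0 measure0. Qed.

Let product_vcons_ge0 A : (0 <= product_vcons A)%E.
Proof. by rewrite /product_vcons /pushforward; exact: measure_ge0. Qed.

Let product_vcons_sigma_additive : semi_sigma_additive product_vcons.
Proof.
move=> F mF tF mUF; rewrite /product_vcons /pushforward preimage_bigcup.
have mV A : measurable A -> measurable (@vcons m @^-1` A).
  by move=> mA; rewrite -[X in measurable X]setTI; exact: measurable_vcons.
apply: measure_semi_sigma_additive.
- by move=> k; exact: mV.
- apply/trivIsetP => /= i j _ _ ij; rewrite -preimage_setI.
  by move/trivIsetP : tF => /(_ _ _ _ _ ij) ->//; rewrite preimage_set0.
- by rewrite -preimage_bigcup; exact: mV.
Qed.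

HB.instance Definition _ := isMeasure.Build _ _ _ product_vcons
  product_vcons0 product_vcons_ge0 product_vcons_sigma_additive.

Let product_vcons_sigma_finite : sigma_finite setT product_vcons.
Proof.
have /sigma_finiteP[F [TF ndF Foo]] := sigma_finiteT nu.
have /sigma_finiteP[G [TG ndG Goo]] := sigma_finiteT mu.
exists (fun i => @vuncons m @^-1` (F i `*` G i)).
  apply/esym; rewrite -subTset => t _.
  have : [set: measurableTypeR R] (vuncons t).1 by [].
  have : [set: vec R m] (vuncons t).2 by [].
  rewrite TF TG => -[j _ Gj] [i _ Fi]; exists (maxn i j) => //; split => /=.
    by move: Fi; exact/subsetPset/ndF/leq_maxl.
  by move: Gj; exact/subsetPset/ndG/leq_maxr.
move=> i; have [mF Fi] := Foo i; have [mG Gi] := Goo i; split.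
  rewrite -[X in measurable X]setTI; apply: measurable_vuncons => //.
  exact: measurableX.
rewrite /product_vcons /pushforward -comp_preimage.
rewrite (_ : _ \o _ = id) ?preimage_id; last first.
  by apply/funext => x; exact: vconsK.
by rewrite product_measure1E// lte_mul_pinfty// ge0_fin_numE.
Qed.

HB.instance Definition _ := Measure_isSigmaFinite.Build _ _ _ product_vcons
  product_vcons_sigma_finite.

End step.

(* The m-dimensional Lebesgue measure: the iterated product of the
   one-dimensional one, see lebesgue_vec_box. *)
Fixpoint lebesgue_vec (m : nat) :
    {sigma_finite_measure set (vec R m) -> \bar R} :=
  match m with
  | 0 => \d_([tuple] : vec R 0)
  | k.+1 => product_vcons lebesgue_measure (lebesgue_vec k)
  end.

Lemma lebesgue_vec_box (m : nat) (A : 'I_m -> set (measurableTypeR R)) :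
  (forall i, measurable (A i)) ->
  lebesgue_vec m [set t | forall i, A i (tnth t i)] =
  (\prod_(i < m) lebesgue_measure (A i))%E.
Proof.
elim: m A => [|m IH] A mA.
  rewrite big_ord0 /= diracE mem_set //=; first by case.
rewrite big_ord_recl /= /product_vcons /pushforward.
rewrite (_ : _ @^-1` _ = A ord0 `*` [set t | forall i, A (lift ord0 i) (tnth t i)]).
  rewrite product_measure1E //; last first.
    rewrite (_ : mkset _ = \bigcap_(i in [set: 'I_m])
      ((@tnth _ (measurableTypeR R) ^~ i) @^-1` A (lift ord0 i))); last first.
      by apply/seteqP; split=> t /= H i; [move=> _; exact: H|exact: H].
    apply: fin_bigcap_measurable => [|i _]; first exact: finite_finset.
    by rewrite -[X in measurable X]setTI; exact: measurable_tnth.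
  by congr (_ * _)%E; rewrite -(IH (fun i => A (lift ord0 i))) // => i; exact: mA.
apply/seteqP; split=> -[x t] /=.
  by move=> H; split=> [|i]; [have := H ord0|have := H (lift ord0 i); rewrite tnthS].
move=> [Ax At] i; case: (unliftP ord0 i) => [j ->|-> //].
by rewrite tnthS.
Qed.

End lebesgue_vec.

Section queries.
Context {R : realType}.

Definition vadd (m : nat) (u v : vec R m) : vec R m :=
  [tuple (tnth u i + tnth v i : R) | i < m].

Definition vsub (m : nat) (u v : vec R m) : vec R m :=
  [tuple (tnth u i - tnth v i : R) | i < m].

Definition norm1 (m : nat) (v : vec R m) : R := \sum_(i < m) `|tnth v i : R|.

Definition norm2 (m : nat) (v : vec R m) : R :=
  Num.sqrt (\sum_(i < m) (tnth v i : R) ^+ 2).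

Definition hamming (n : nat) (D D' : vec R n) : nat :=
  #|[set i : 'I_n | tnth D i != tnth D' i]%SET|.

Definition adjacent_in (n : nat) (DB : set (vec R n)) (D D' : vec R n) : Prop :=
  [/\ DB D, DB D' & hamming D D' = 1%N].

(* Measurability of a map DB -> R^m for the trace sigma-algebra on DB. The
   library's [measurable_fun DB W] says the same when DB is measurable, but is
   vacuous when it is not. *)
Definition measurable_query (n m : nat) (DB : set (vec R n))
    (W : vec R n -> vec R m) : Prop :=
  forall B, measurable B ->
    exists2 A, measurable A & DB `&` W @^-1` B = DB `&` A.

Definition sensitivity (n m : nat) (nrm : vec R m -> R) (DB : set (vec R n))
    (W : vec R n -> vec R m) : \bar R :=
  ereal_sup [set (nrm (vsub (W DD.1) (W DD.2)))%:E
            | DD in [set DD | adjacent_in DB DD.1 DD.2]].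

End queries.

Section divergence.
Context {R : realType} {m : nat}.
Implicit Types (p : vec R m -> R) (mu : set (vec R m) -> \bar R).
Local Open Scope ereal_scope.

Definition is_density mu p : Prop :=
  [/\ measurable_fun [set: vec R m] p,
      (forall x, (0 <= p x)%R) &
      forall A, measurable A -> mu A = \int[lebesgue_vec m]_(x in A) (p x)%:E].

(* x ^ r for x >= 0, with 0 ^ r = +oo when r < 0 (the library's powR gives 0). *)
Definition epow (x r : R) : \bar R :=
  if (x == 0%R) && (r < 0)%R then +oo else (x `^ r)%:E.

(* The value at lam different from -1 and 0. The expectation under p2 ignores
   {p2 = 0}, because 0 * y = 0 for every extended real y. *)
Definition power_div (lam : R) p1 p2 : \bar R :=
  ((lam * (lam + 1))^-1)%:E *
  \int[lebesgue_vec m]_x ((epow (p1 x / p2 x) (lam + 1) - 1) * (p2 x)%:E).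

(* [is_power_divergence lam P1 P2 d]: P1 and P2 have densities and
   D_lam(P1, P2) = d. This does not depend on the choice of the densities; at
   lam = 0 and lam = -1 the limit is required to exist. *)
Definition is_power_divergence (lam : R) (P1 P2 : set (vec R m) -> \bar R)
    (d : \bar R) : Prop :=
  exists p1 p2, [/\ is_density P1 p1, is_density P2 p2 &
    if (lam == 0%R) || (lam == (- 1)%R)
    then power_div x p1 p2 @[x --> lam^'] --> d
    else d = power_div lam p1 p2].

End divergence.

Section mechanisms.
Context {R : realType} {d : measure_display} {Omega : measurableType d}.
Variables (P : probability Omega R) (n m : nat).
Variables (DB : set (vec R n)) (W : vec R n -> vec R m).
Implicit Type M : vec R m -> vec R n -> Omega -> vec R m.

Definition output_law M (D : vec R n) : set (vec R m) -> \bar R :=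
  pushforward P (M (W D) D).

Definition PDP (lam eps : R) M : Prop :=
  forall D D', adjacent_in DB D D' ->
    exists2 v, is_power_divergence lam (output_law M D) (output_law M D') v &
      (v <= eps%:E)%E.

Definition HDP (eps : R) M : Prop :=
  forall D D', adjacent_in DB D D' ->
    exists p1 p2, [/\ is_density (output_law M D) p1,
      is_density (output_law M D') p2 &
      (\int[lebesgue_vec m]_x
        ((Num.sqrt (p1 x) - Num.sqrt (p2 x)) ^+ 2)%:E <= eps%:E)%E].

(* The noise Y is one random vector, the same for all datasets: this is its
   independence of the (deterministic) data. *)
Definition additive_mechanism (Y : 'I_m -> {RV P >-> R}) :
    vec R m -> vec R n -> Omega -> vec R m :=
  fun w _ omega => vadd w [tuple (Y i omega : measurableTypeR R) | i < m].

Definition mutually_independent (Y : 'I_m -> {RV P >-> R}) : Prop :=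
  forall (J : {set 'I_m}) (B : 'I_m -> set R),
    (forall i, measurable (B i)) ->
    P (\bigcap_(i in [set` J]) (Y i @^-1` B i)) =
    (\prod_(i in J) P (Y i @^-1` B i))%E.

Definition iid_with_law (nu : set R -> \bar R) (Y : 'I_m -> {RV P >-> R}) :
    Prop :=
  mutually_independent Y /\
  forall i A, measurable A -> distribution P (Y i) A = nu A.

End mechanisms.

Section noise.
Context {R : realType}.
Implicit Types lam eps Delta : R.

(* N(0, s2), parametrized by the variance. *)
Definition gaussian (s2 : R) : set R -> \bar R := normal_prob 0 (Num.sqrt s2).

Definition laplace_pdf (b y : R) : R := (2 * b)^-1 * expR (- `|y| / b).

Definition laplace (b : R) : set R -> \bar R :=
  fun A => (\int[lebesgue_measure]_(y in A) (laplace_pdf b y)%:E)%E.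

Definition admissible lam eps : Prop :=
  0 < eps /\
  (lam * (lam + 1) < 0 -> eps < - (lam * (lam + 1))^-1).

Definition sigma2 lam eps Delta : R :=
  if lam * (lam + 1) != 0 then
    Delta ^+ 2 * (lam * (lam + 1) / (2 * ln (1 + lam * (lam + 1) * eps)))
  else Delta ^+ 2 * (1 / (2 * eps)).

Definition laplace_scale lam eps Delta : R :=
  if lam * (lam + 1) != 0 then
    Num.max
      (Num.sg lam * (lam + 1) * Delta / ln (lam * (lam + 1) * eps + 1))
      (Num.sg (lam + 1) * lam * Delta / ln (lam * (lam + 1) * eps + 1))
  else Delta / eps.

Definition sigma2_HDP eps Delta : R :=
  Delta ^+ 2 / (8 * ln (1 / (1 - 2^-1 * eps))).

Definition laplace_scale_HDP eps Delta : R :=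
  Delta / (2 * ln (1 / (1 - 2^-1 * eps))).

End noise.

(* Main.v *)
Require Import Defs.
From HB Require Import structures.
From mathcomp Require Import all_boot all_order all_algebra.
From mathcomp Require Import all_classical all_reals all_analysis.
From mathcomp Require Import measurable_realfun.
From mathcomp Require Import ring lra.

Set Implicit Arguments.
Unset Strict Implicit.
Unset Printing Implicit Defensive.

Import Order.TTheory GRing.Theory Num.Def Num.Theory.
Import numFieldNormedType.Exports.

Local Open Scope classical_set_scope.
Local Open Scope ring_scope.

(* By independence and translation invariance, u + Y has the product density
   p_u(x) = prod_i f(x_i - u_i). With l = log(p_u / p_v), one has
   lam (lam + 1) D_lam = E_{p_u}[exp(lam l)] - 1.
   For Gaussian noise, completing the square gives
   exp(lam l) p_u = exp(lam (lam + 1) k) p_w, where k = |u - v|^2 / (2 sigma^2)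
   and w = (lam + 1) u - lam v, so the expectation is exp(lam (lam + 1) k).
   For Laplace noise, |l| <= a := |u - v|_1 / b pointwise, so the expectation
   lies between exp(- |lam| a) and exp(|lam| a).
   The limits at lam = 0, -1 come from |exp t - 1 - t| <= t^2 exp |t|. *)

(** * Density of additive noise *)

Lemma measurable_subr (R : realType) (c : R) :
  measurable_fun [set: measurableTypeR R]
    (fun x => (x - c : measurableTypeR R)).
Proof. by apply: measurable_funB. Qed.

(** By uniqueness of Lebesgue measure: the preimage of a half-open interval has both endpoints
    shifted by [c], hence the same length. *)
Lemma lebesgue_measure_translation (R : realType) (c : R) (A : set R) :
  measurable A ->
  pushforward lebesgue_measure
    (fun x : measurableTypeR R => (x - c : measurableTypeR R)) A
  = lebesgue_measure A.
Proof.
move=> mA; apply/esym/lebesgue_measure_unique => //=.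
  exact: measurable_subr.
move=> mf _ [[a b]] _ <-; rewrite /pushforward.
rewrite (_ : _ @^-1` _ = `](a + c), (b + c)]%classic); last first.
  by apply/seteqP; split => x; rewrite /= !in_itv/= ltrBrDr lerBlDr.
rewrite !lebesgue_measure_itv/= !lte_fin ltrD2r.
by case: ifP => // _; rewrite -EFinD; congr EFin; rewrite opprD addrACA subrr addr0.
Qed.

Lemma ge0_integral_translation (R : realType) (c : R) (A : set R)
    (f : R -> \bar R) :
  measurable A -> measurable_fun [set: R] f -> (forall x, (0 <= f x)%E) ->
  (\int[@lebesgue_measure R]_(x in [set x : R | A (x + c)%R]) f x =
   \int[@lebesgue_measure R]_(x in A) f (x - c)%R)%E.
Proof.
move=> mA mf f0.
have mB : measurable [set x : R | A (x + c)].
  rewrite (_ : mkset _ = setT `&` (fun x => x - - c) @^-1` A); last first.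
    by apply/seteqP; split=> x /=; rewrite opprK => // -[].
  exact: measurable_subr.
set B := [set x : R | A (x + c)].
have -> : A = (fun x : measurableTypeR R => (x - c : measurableTypeR R)) @^-1` B.
  by apply/seteqP; split=> x; rewrite /B /= subrK.
have := ge0_integral_pushforward (measurable_subr c) lebesgue_measure mB
  (measurable_funS measurableT (@subsetT _ _) mf) (fun y _ => f0 y).
rewrite /comp => <-.
apply: eq_measure_integral => //=; first exact: measurable_subr.
by move=> mphi C mC _; rewrite -(lebesgue_measure_translation c mC).
Qed.

Lemma measurable_fun_prod_tnth (R : realType) (m : nat) (g : 'I_m -> R -> R) :
  (forall i, measurable_fun [set: R] (g i)) ->
  measurable_fun [set: vec R m] (fun x : vec R m => \prod_(i < m) g i (tnth x i)).
Proof.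
move=> mg; apply: measurable_prod => i _.
exact: (measurableT_comp (mg i) (@measurable_tnth _ _ _ i)).
Qed.

(** Tonelli, by induction on [m], peeling off the first coordinate. For [m = 0] the measure is a
    Dirac mass and both sides are empty products. *)
Lemma integral_prod_tnth (R : realType) (m : nat) (g : 'I_m -> R -> R) :
  (forall i, measurable_fun [set: R] (g i)) -> (forall i x, 0 <= g i x) ->
  (\int[lebesgue_vec m]_x (\prod_(i < m) g i (tnth x i))%:E =
   \prod_(i < m) \int[lebesgue_measure]_y (g i y)%:E)%E.
Proof.
elim: m g => [|m IH] g mg g0.
  rewrite /= integral_dirac; last 2 first.
  - exact: measurableT.
  - by apply/measurable_EFinP; exact: (measurable_fun_prod_tnth mg).
  by rewrite diracT mul1e !big_ord0.
rewrite [LHS]/=.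
have mf := measurable_fun_prod_tnth mg.
have mfE : measurable_fun [set: vec R m.+1]
   (fun x : vec R m.+1 => (\prod_(i < m.+1) g i (tnth x i))%:E).
  exact/measurable_EFinP.
have pos (x : vec R m.+1) : (0 <= (\prod_(i < m.+1) g i (tnth x i))%:E)%E.
  by rewrite lee_fin prodr_ge0.
rewrite (ge0_integral_pushforward (@measurable_vcons R m)) //=.
rewrite fubini_tonelli1 //=; last first.
  exact: (measurableT_comp mfE (@measurable_vcons R m)).
rewrite /fubini_F big_ord_recl.
set C := (X in (_ * X)%E).
have C0 : (0 <= C)%E.
  by apply: prode_ge0 => i _; apply: integral_ge0 => y _; rewrite lee_fin.
rewrite -ge0_integralZr //=; last 2 first.
- by apply/measurable_EFinP; exact: (mg ord0).
- by move=> y _; rewrite lee_fin.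
apply: eq_integral => x _; rewrite /C -(IH (fun i => g (lift ord0 i))) //.
rewrite -ge0_integralZl //=; last 3 first.
- apply/measurable_EFinP.
  exact: (measurable_fun_prod_tnth (fun i => mg (lift ord0 i))).
- by move=> y _; rewrite lee_fin prodr_ge0.
- by rewrite lee_fin.
apply: eq_integral => y _; rewrite -EFinM big_ord_recl; congr (_ * _)%:E.
by apply: eq_bigr => i _; rewrite /vcons tnthS.
Qed.

(** * Measures given by a density, and uniqueness of measures on boxes *)

Section density_measure.
Context {d : measure_display} {T : measurableType d} {R : realType}.
Variables (mu : {measure set T -> \bar R}) (p : T -> R).
Hypotheses (mp : measurable_fun [set: T] p) (p0 : forall x, 0 <= p x).

(** Packaged as a measure so that uniqueness on boxes can be applied to it. *)
Definition density_measure (A : set T) : \bar R :=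
  (\int[mu]_(x in A) (p x)%:E)%E.

Let density_measure0 : density_measure set0 = 0%E.
Proof. by rewrite /density_measure integral_set0. Qed.

Let density_measure_ge0 A : (0 <= density_measure A)%E.
Proof. by apply: integral_ge0 => x _; rewrite lee_fin. Qed.

Let density_measure_sigma_additive : semi_sigma_additive density_measure.
Proof.
move=> /= F mF tF mUF; rewrite /density_measure ge0_integral_bigcup //=.
- apply: is_cvg_nneseries => n _ _.
  exact: density_measure_ge0.
- by apply/measurable_EFinP; exact: measurable_funS mp.
- by move=> x _; rewrite lee_fin.
Qed.

HB.instance Definition _ := isMeasure.Build _ _ _ density_measure
  density_measure0 density_measure_ge0 density_measure_sigma_additive.

End density_measure.

Section boxes.
Context {R : realType} {m : nat}.

Definition vbox (A : 'I_m -> set R) : set (vec R m) :=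
  [set t | forall i, A i (tnth t i)].

Definition vboxes : set (set (vec R m)) :=
  [set vbox A | A in [set A | forall i, measurable (A i)]].

Lemma measurable_vbox A : (forall i, measurable (A i)) -> measurable (vbox A).
Proof.
move=> mA; rewrite (_ : vbox A = \bigcap_(i in [set: 'I_m])
  ((@tnth _ (measurableTypeR R) ^~ i) @^-1` A i)); last first.
  by apply/seteqP; split=> t /= H i; [move=> _; exact: H|exact: H].
apply: fin_bigcap_measurable => [|i _]; first exact: finite_finset.
by rewrite -[X in measurable X]setTI; apply: measurable_tnth => //; exact: mA.
Qed.

Lemma setI_closed_vboxes : setI_closed vboxes.
Proof.
move=> _ _ [A mA <-] [B mB <-]; exists (fun i => A i `&` B i).
  by move=> i; exact: measurableI.
apply/seteqP; split=> t /=; first by move=> H; split=> i; have [] := H i.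
by move=> [HA HB] i; split; [exact: HA|exact: HB].
Qed.

(** A coordinate cylinder is the box whose other sides are the whole line, so boxes generate the
    same sigma-algebra as the coordinates. *)
Lemma measurable_vec_generated :
  @measurable _ (vec R m) = <<s vboxes >>.
Proof.
apply/seteqP; split; last first.
  apply: smallest_sub; first exact: sigma_algebra_measurable.
  by move=> _ [A mA <-]; exact: measurable_vbox.
apply: smallest_sub; first exact: smallest_sigma_algebra.
move=> B; rewrite -bigcup_seq => -[/= i _ [A mA <-]].
apply: sub_sigma_algebra.
exists (fun j => if j == i then A else setT).
  by move=> j; case: ifP.
apply/seteqP; split=> t /=.
  by move=> /(_ i); rewrite eqxx; split.
by move=> [_ At] j; case: eqP => // ->.
Qed.

End boxes.

(** Boxes form a generating pi-system containing the whole space; as [mu] is finite, the constant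
    sequence [setT] serves as exhaustion. *)
Lemma vec_measure_unique (R : realType) (m : nat)
    (mu nu : {measure set (vec R m) -> \bar R}) :
  (mu setT < +oo)%E ->
  (forall A, (forall i, measurable (A i)) -> mu (vbox A) = nu (vbox A)) ->
  forall A, measurable A -> mu A = nu A.
Proof.
move=> muT munu A mA.
apply: (@measure_unique _ _ _ vboxes (fun=> setT)) => //.
- exact: measurable_vec_generated.
- exact: setI_closed_vboxes.
- move=> _; exists (fun=> setT) => //; exact/seteqP.
- by rewrite -subTset => x _; exists 0%N.
- by move=> _ [B mB <-]; exact: munu.
Qed.

Definition shifted_pdf (R : realType) (f : R -> R) (m : nat) (u x : vec R m) : R :=
  \prod_(i < m) f (tnth x i - tnth u i).

Section additive_noise.
Context {R : realType} {d : measure_display} {Omega : measurableType d}.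
Variables (P : probability Omega R) (m : nat) (Y : 'I_m -> {RV P >-> R}).
Variables (f : R -> R) (nu : set R -> \bar R).
Hypotheses (mf : measurable_fun [set: R] f) (f0 : forall x, 0 <= f x).
Hypothesis nuE : forall A : set R, measurable A ->
  nu A = (\int[@lebesgue_measure R]_(x in A) (f x)%:E)%E.
Hypothesis Ynu : iid_with_law nu Y.

Definition noisy (u : vec R m) (omega : Omega) : vec R m :=
  vadd u [tuple (Y i omega : measurableTypeR R) | i < m].

Let mfc (c : R) : measurable_fun [set: R] (fun x => f (x - c)).
Proof. by apply: measurableT_comp mf _; exact: measurable_funB. Qed.

Let measurable_noisy u : measurable_fun [set: Omega] (noisy u).
Proof.
apply/measurable_fun_tnthP => i.
rewrite (_ : _ \o _ = (fun omega => tnth u i + Y i omega)).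
  by apply: measurable_funD => //; exact: measurable_funPT.
by apply/funext => omega; rewrite /noisy /vadd /= !tnth_mktuple.
Qed.

Lemma measurable_shifted_pdf u : measurable_fun [set: vec R m] (shifted_pdf f u).
Proof.
exact: (@measurable_fun_prod_tnth R m (fun i y => f (y - tnth u i))).
Qed.

Let integral_vbox (u : vec R m) (A : 'I_m -> set R) :
  (forall i, measurable (A i)) ->
  (\int[lebesgue_vec m]_(x in vbox A) (shifted_pdf f u x)%:E =
   \prod_(i < m) \int[@lebesgue_measure R]_(y in A i) (f (y - tnth u i))%:E)%E.
Proof.
move=> mA.
(* Cutting each factor off outside [A i] turns the integral over the box into a full integral of a
   product: outside the box some factor vanishes. *)
pose g i : R -> R := (fun y => f (y - tnth u i)) \_ (A i).
transitivity (\int[lebesgue_vec m]_x (\prod_(i < m) g i (tnth x i))%:E)%E.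
  rewrite integral_mkcond; apply: eq_integral => x _; rewrite /patch.
  case: ifPn => [/set_mem xA|/negP xA]; congr EFin.
    by apply: eq_bigr => i _; rewrite /g /patch mem_set //; exact: xA.
  have /existsNP[i Ai] : ~ (forall i, A i (tnth x i)).
    by move=> H; apply: xA; exact: mem_set.
  by rewrite (bigD1 i) //= /g /patch memNset // mul0r.
rewrite integral_prod_tnth.
- apply: eq_bigr => i _; rewrite [RHS]integral_mkcond.
  by apply: eq_integral => y _; rewrite /g /patch; case: ifP.
- by move=> i; apply/(measurable_restrictT _ (mA i)); exact: measurable_funS (mfc _).
- by move=> i x; rewrite /g /patch; case: ifP.
Qed.

(** The two measures agree on boxes: independence factorizes the probability, and a translation by
    [u] turns each factor into the matching one-dimensional integral. *)
Lemma is_density_shifted_pdf u :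
  is_density (pushforward P (noisy u)) (shifted_pdf f u).
Proof.
split; first exact: measurable_shifted_pdf.
  by move=> x; exact: prodr_ge0.
move=> A mA.
rewrite -[RHS]/(density_measure (lebesgue_vec m) (shifted_pdf f u) A).
apply: (vec_measure_unique _ _ mA) => /=.
- exact: measurable_shifted_pdf.
- by move=> x; exact: prodr_ge0.
- by rewrite /pushforward preimage_setT probability_setT ltry.
move=> mp p0 B mB; rewrite /density_measure integral_vbox // /pushforward.
pose B' i := [set y | B i (y + tnth u i)].
have mB' i : measurable (B' i).
  rewrite (_ : B' i = setT `&` (fun x => x - - tnth u i) @^-1` B i).
    by apply: measurable_subr => //; exact: mB.
  by apply/seteqP; split=> x /=; rewrite opprK /B' /= => // -[].
have [indep law] := Ynu.
transitivity (P (\bigcap_(i in [set` [set: 'I_m]%SET]) (Y i @^-1` B' i))).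
  congr (P _); apply/seteqP; split=> w /=.
    by move=> H i _; have := H i; rewrite /B' /= /noisy /vadd !tnth_mktuple addrC.
  move=> H i; have := H i; rewrite /= finset.in_setT /B' /= => /(_ isT).
  by rewrite /noisy /vadd !tnth_mktuple addrC.
rewrite indep //; apply: eq_big => [i|i _]; first by rewrite finset.in_setT.
have /= := law i _ (mB' i); rewrite nuE // /distribution /pushforward => ->.
rewrite (@ge0_integral_translation _ (tnth u i) (B i) (fun x => (f x)%:E)) //.
by apply/measurable_EFinP.
Qed.

End additive_noise.

(** * Power divergence and its limits at 0 and -1 *)

(** From [exp t >= 1 + t] and [exp (-t) >= 1 - t] one gets [0 <= exp t - 1 - t <= t (exp t - 1)].
    The same two bounds control [exp t - 1], according to the sign of [t]. *)
Lemma expR_taylor1 (R : realType) (t : R) :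
  `|expR t - 1 - t| <= t ^+ 2 * expR `|t|.
Proof.
have h1 := expR_ge1Dx t; have h2 := expR_ge1Dx (- t).
have e0 := expR_gt0 t.
have ubt : expR t - 1 <= t * expR t.
  have : (1 - t) * expR t <= 1.
    apply: (@le_trans _ _ (expR (- t) * expR t)); first by rewrite ler_pM2r.
    by rewrite -expRD addNr expR0.
  by rewrite mulrBl mul1r; lra.
rewrite ger0_norm; last lra.
have [t0|t0] := leP 0 t.
  by rewrite (ger0_norm t0); nra.
rewrite ltr0_norm //.
have : 1 <= expR (- t) by apply: le_trans h2; lra.
by nra.
Qed.

(** * Expectations and exponential moments under a probability density *)

Section mean.
Context {d : measure_display} {T : measurableType d} {R : realType}.
Variables (mu : {measure set T -> \bar R}) (p : T -> R).
Hypotheses (mp : measurable_fun [set: T] p) (p0 : forall x, 0 <= p x).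
Hypothesis p1 : (\int[mu]_x (p x)%:E = 1)%E.

(** Real-valued, hence meaningful when [h * p] is integrable; below this follows from boundedness of
    [h]. *)
Definition mean (h : T -> R) : R := \int[mu]_x (h x * p x).

Lemma integrable_pdf : mu.-integrable setT (EFin \o p).
Proof.
apply/integrableP; split; first exact/measurable_EFinP.
under eq_integral do rewrite /= ger0_norm //.
by rewrite p1 ltry.
Qed.

Lemma integrable_bounded_pdf (h : T -> R) (B : R) :
  measurable_fun [set: T] h -> (forall x, `|h x| <= B) ->
  mu.-integrable setT (EFin \o (fun x => h x * p x)).
Proof.
move=> mh hB.
apply: (@le_integrable _ _ _ _ _ measurableT _ (fun x => B%:E * (EFin \o p) x)%E).
- by apply/measurable_EFinP; exact: measurable_funM.
- move=> x _; rewrite /= lee_fin !normrM (ger0_norm (p0 x)).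
  by rewrite ler_wpM2r // (le_trans (hB x)) // ler_norm.
- exact: integrableZl integrable_pdf.
Qed.

Lemma mean_cst c : mean (fun=> c) = c.
Proof.
rewrite /mean RintegralZl //; last exact: integrable_pdf.
by rewrite /Rintegral p1 mulr1.
Qed.

Lemma mean_bounds (h : T -> R) (a b : R) : measurable_fun [set: T] h ->
  (forall x, a <= h x <= b) -> a <= mean h <= b.
Proof.
move=> mh hab.
have hB x : `|h x| <= Num.max `|a| `|b|.
  have /andP[ha hb] := hab x; rewrite ler_norml; apply/andP; split.
    rewrite lerNl (le_trans (_ : _ <= - a)) ?lerN2 //.
    by rewrite (le_trans (ler_norm _)) // normrN le_max lexx.
  by rewrite (le_trans hb) // (le_trans (ler_norm _)) // le_max lexx orbT.
have ih := integrable_bounded_pdf mh hB.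
have ic c : mu.-integrable setT (EFin \o (fun x => c * p x)).
  by apply: (@integrable_bounded_pdf (fun=> c) `|c|).
apply/andP; split.
  rewrite -[leLHS]mean_cst; apply: le_Rintegral => // x _.
  by rewrite ler_wpM2r //; case/andP: (hab x).
rewrite -[leRHS]mean_cst; apply: le_Rintegral => // x _.
by rewrite ler_wpM2r //; case/andP: (hab x).
Qed.

Variables (l : T -> R) (a : R).
Hypotheses (ml : measurable_fun [set: T] l) (la : forall x, `|l x| <= a).

Let measurable_expl t : measurable_fun [set: T] (fun x => expR (t * l x)).
Proof. by apply: measurableT_comp => //; exact: measurable_funM. Qed.

Lemma expR_mul_bounds t x : expR (- (`|t| * a)) <= expR (t * l x) <= expR (`|t| * a).
Proof.
by rewrite !ler_expR -ler_norml normrM ler_wpM2l.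
Qed.

Lemma integrable_expl t :
  mu.-integrable setT (EFin \o (fun x => expR (t * l x) * p x)).
Proof.
apply: (@integrable_bounded_pdf _ (expR (`|t| * a))) => // x.
by rewrite ger0_norm ?expR_ge0 //; case/andP: (expR_mul_bounds t x).
Qed.

Lemma mean_expl_bounds t :
  expR (- (`|t| * a)) <= mean (fun x => expR (t * l x)) <= expR (`|t| * a).
Proof. by apply: mean_bounds => // x; exact: expR_mul_bounds. Qed.

(** The pointwise bound [expr_taylor1] at [t * l x], integrated against [p]; the left side is the
    mean of the pointwise remainder by linearity. *)
Lemma mean_expl_taylor t :
  `|mean (fun x => expR (t * l x)) - 1 - t * mean l| <=
  t ^+ 2 * (a ^+ 2 * expR (`|t| * a)).
Proof.
pose rest x := expR (t * l x) - 1 - t * l x.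
have a0 : 0 <= a by apply: le_trans (la point).
have -> : mean (fun x => expR (t * l x)) - 1 - t * mean l = mean rest.
  have i1 := integrable_pdf.
  have il := integrable_bounded_pdf ml la.
  rewrite -[X in _ - X - _](mean_cst 1) /mean -RintegralZl //.
  rewrite -RintegralB //; last 2 first.
  - exact: integrable_expl.
  - by apply: (@integrable_bounded_pdf (fun=> 1) 1) => // x; rewrite normr1.
  rewrite -RintegralB //; last 2 first.
  - rewrite (_ : _ \o _ = (EFin \o (fun x => (expR (t * l x) - 1) * p x))).
      apply: (@integrable_bounded_pdf _ (expR (`|t| * a) + 1)) => // [|x].
        exact: measurable_funB.
      rewrite (le_trans (ler_normB _ _)) // normr1 lerD2r.
      by rewrite ger0_norm ?expR_ge0 //; case/andP: (expR_mul_bounds t x).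
    by apply/funext => x /=; rewrite mulrBl.
  - rewrite (_ : _ \o _ = (fun x => t%:E * (l x * p x)%R%:E)%E) //.
    exact: integrableZl.
  by apply: eq_Rintegral => x _; rewrite /rest; ring.
rewrite ler_norml; apply: mean_bounds.
  apply: measurable_funB; last exact: measurable_funM.
  exact: measurable_funB.
move=> x; rewrite -ler_norml (le_trans (expR_taylor1 _)) // exprMn -mulrA.
rewrite ler_wpM2l ?sqr_ge0 // ler_pM ?expR_ge0 ?sqr_ge0 //.
  by rewrite -real_normK ?num_real // ler_pXn2r ?nnegrE.
by rewrite ler_expR normrM ler_wpM2l.
Qed.

End mean.

(** Dividing the hypothesis by [x (x + 1)] leaves an error of at most [|x - lam| B], which tends to
    0. *)
Lemma cvg_power_factor (R : realType) (lam K B : R) (N : R -> R) :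
  lam * (lam + 1) = 0 ->
  (forall x, `|x - lam| <= 2^-1 ->
    `|N x - x * (x + 1) * K| <= `|x * (x + 1)| * (`|x - lam| * B)) ->
  (x * (x + 1))^-1 * N x @[x --> lam^'] --> K.
Proof.
move=> lam0 NK.
have lin : `|x - lam| * B @[x --> lam^'] --> (0 : R).
  rewrite -[X in _ --> X](mul0r B); apply: cvgMr_tmp.
  have /= : `|x - lam| @[x --> lam^'] --> `|lam - lam|.
    apply: cvg_within_filter; apply: cvg_norm; apply: cvgB; first exact: cvg_id.
    exact: cvg_cst.
  by rewrite subrr normr0.
suff dist0 : `|(x * (x + 1))^-1 * N x - K| @[x --> lam^'] --> (0 : R).
  by apply/subr_cvg0; exact: norm_cvg0 dist0.
apply: (squeeze_cvgr _ (cvg_cst (0 : R)) lin).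
near=> x.
have xlam : x != lam by near: x; exact: nbhs_dnbhs_neq.
have xn : `|x - lam| <= 2^-1.
  near: x; apply: nbhs_dnbhs; exists 2^-1 => //= y /ltW.
  by rewrite distrC.
have s0 : x * (x + 1) != 0.
  (* Since [2 lam + 1] is 1 or -1, the second factor stays away from 0 when [|x - lam| <= 1/2]. *)
  rewrite (_ : x * (x + 1) = (x - lam) * (x - lam + (2 * lam + 1))); last first.
    by rewrite -[LHS]subr0 -lam0; ring.
  rewrite mulf_neq0 ?subr_eq0 // -normr_gt0.
  have : `|2 * lam + 1| = 1.
    by move/eqP: lam0; rewrite mulf_eq0 addr_eq0 => /orP[] /eqP ->;
      [rewrite mulr0 add0r normr1
      |rewrite mulrN1 (_ : - 2 + 1 = -1) ?normrN1 //; ring].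
  have := ler_normB (x - lam + (2 * lam + 1)) (x - lam).
  rewrite (_ : x - lam + (2 * lam + 1) - (x - lam) = 2 * lam + 1); last ring.
  by move=> + sg1; rewrite sg1; lra.
rewrite normr_ge0 /=.
rewrite (_ : _ - K = (x * (x + 1))^-1 * (N x - x * (x + 1) * K)); last first.
  by rewrite mulrBr mulrA mulVf // mul1r.
by rewrite normrM normfV ler_pdivrMl ?normr_gt0 // NK.
Unshelve. all: by end_near.
Qed.

(** * Power divergence as an exponential moment of the log-ratio *)

Section power_divergence_of_positive_densities.
Context {R : realType} {m : nat}.
Variables (p1 p2 l : vec R m -> R).
Hypotheses (mp1 : measurable_fun [set: vec R m] p1)
  (mp2 : measurable_fun [set: vec R m] p2).
Hypothesis p2_gt0 : forall x, 0 < p2 x.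
Hypothesis p1E : forall x, p1 x = expR (l x) * p2 x.
Hypothesis p1_int : (\int[lebesgue_vec m]_x (p1 x)%:E = 1)%E.
Hypothesis p2_int : (\int[lebesgue_vec m]_x (p2 x)%:E = 1)%E.
Hypothesis ml : measurable_fun [set: vec R m] l.

Let p1_ge0 x : 0 <= p1 x.
Proof. by rewrite p1E mulr_ge0 ?expR_ge0 // ltW. Qed.

(** With [p1 = exp(l) p2] the integrand [(exp((lam + 1) l) - 1) p2] equals [exp(lam l) p1 - p2].
    This covers [lam = 0] and [lam = -1] too, where the inverse of 0 is 0 on both sides, so it can
    be rewritten under a limit. *)
Lemma power_divE (lam c : R) :
  (\int[lebesgue_vec m]_x (expR (lam * l x) * p1 x)%:E = c%:E)%E ->
  power_div lam p1 p2 = ((lam * (lam + 1))^-1 * (c - 1))%:E.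
Proof.
move=> cE; rewrite /power_div EFinM; congr (_ * _)%E.
transitivity (\int[lebesgue_vec m]_x
    ((expR (lam * l x) * p1 x)%:E - (p2 x)%:E))%E.
  apply: eq_integral => x _; rewrite /epow.
  rewrite (_ : p1 x / p2 x = expR (l x)); last first.
    by rewrite p1E mulfK // gt_eqF.
  (* The ratio is positive, so [epow] is the ordinary real power. *)
  rewrite (gt_eqF (expR_gt0 _)) /= -expRM -EFinB -EFinM; congr EFin.
  rewrite mulrBl mul1r p1E mulrA -expRD; congr (expR _ * _ - _); ring.
rewrite integralB_EFin //.
- by rewrite cE p2_int.
- apply/integrableP; split.
    apply/measurable_EFinP; apply: measurable_funM => //.
    by apply: measurableT_comp => //; exact: measurable_funM.
  under eq_integral do rewrite /= ger0_norm ?mulr_ge0 ?expR_ge0 //.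
  by rewrite cE ltry.
- by apply: integrable_pdf => // x; exact: ltW.
Qed.

Section bounded_log_ratio.
Variable a : R.
Hypothesis la : forall x, `|l x| <= a.

Let p2_ge0 x : 0 <= p2 x. Proof. exact: ltW. Qed.

Lemma power_div_meanl lam : power_div lam p1 p2 =
  ((lam * (lam + 1))^-1 *
   (mean (lebesgue_vec m) p1 (fun x => expR (lam * l x)) - 1))%:E.
Proof.
apply: power_divE; rewrite /mean /Rintegral fineK //.
by apply: integrable_fin_num => //; exact: (integrable_expl _ _ _ _ la).
Qed.

(** Passing from [p1] to [p2] raises the exponent from [lam] to [lam + 1]. This form has a small
    exponent near -1, the previous one near 0. *)
Lemma power_div_meanr lam : power_div lam p1 p2 =
  ((lam * (lam + 1))^-1 *
   (mean (lebesgue_vec m) p2 (fun x => expR ((lam + 1) * l x)) - 1))%:E.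
Proof.
rewrite power_div_meanl; congr (_ * (_ - _))%:E; apply: eq_Rintegral => x _.
by rewrite p1E mulrA -expRD; congr (expR _ * _); ring.
Qed.

End bounded_log_ratio.
End power_divergence_of_positive_densities.

(** * Gaussian and Laplace noise *)

Section exponential_form.
Context {R : realType} {m : nat}.
Variables (f q : R -> R) (c : R).
Hypotheses (c_gt0 : 0 < c) (fE : forall y, f y = c * expR (- q y)).
Implicit Types u v x : vec R m.

(** The logarithm of [p_u / p_v] at [x]; the normalizing constant [c] cancels. *)
Definition log_ratio u v x : R :=
  \sum_(i < m) (q (tnth x i - tnth v i) - q (tnth x i - tnth u i)).

Lemma shifted_pdf_gt0 u x : 0 < shifted_pdf f u x.
Proof. by apply: prodr_gt0 => i _; rewrite fE mulr_gt0 // expR_gt0. Qed.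

Lemma shifted_pdf_ratio u v x :
  shifted_pdf f u x = expR (log_ratio u v x) * shifted_pdf f v x.
Proof.
rewrite /log_ratio expR_sum -big_split /=; apply: eq_bigr => i _.
by rewrite !fE mulrCA -expRD; congr (_ * expR _); ring.
Qed.

Lemma measurable_log_ratio u v : measurable_fun [set: R] q ->
  measurable_fun [set: vec R m] (log_ratio u v).
Proof.
move=> mq; apply: measurable_sum => i.
have mqi w : measurable_fun [set: vec R m]
    (fun x : vec R m => q (tnth x i - tnth w i)).
  have mqw : measurable_fun [set: R] (fun y => q (y - tnth w i)).
    by apply: measurableT_comp mq _; exact: measurable_funB.
  exact: (measurableT_comp mqw (@measurable_tnth _ _ _ i)).
by apply: measurable_funB.
Qed.

End exponential_form.

(** One factor of [x (x + 1)] is [x - lam]; the other has absolute value between 1/2 and 3/2. *)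
Lemma power_factor_bounds (R : realType) (lam x : R) :
  lam * (lam + 1) = 0 -> `|x - lam| <= 2^-1 ->
  `|x - lam| <= 2 * `|x * (x + 1)| /\ `|x * (x + 1)| <= 2 * `|x - lam|.
Proof.
move=> /eqP; rewrite mulf_eq0 addr_eq0 => /orP[] /eqP ->.
  rewrite subr0 normrM; have := normr_ge0 x.
  have := ler_normB (x + 1) x; rewrite (_ : x + 1 - x = 1); last ring.
  by have := ler_normD x 1; rewrite normr1 => ? ? ? ?; split; nra.
rewrite opprK normrM; have := normr_ge0 (x + 1).
have := ler_normB (x + 1) x; rewrite (_ : x + 1 - x = 1); last ring.
have := ler_normB (x + 1) 1; rewrite (_ : x + 1 - 1 = x); last ring.
by rewrite normr1 => ? ? ? ?; split; nra.
Qed.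

Lemma cvg_expR_power_factor (R : realType) (lam k : R) :
  lam * (lam + 1) = 0 -> 0 <= k ->
  (x * (x + 1))^-1 * (expR (x * (x + 1) * k) - 1) @[x --> lam^'] --> k.
Proof.
(* With [t = x (x + 1) k], one factor [|x (x + 1)|] of [t^2] is kept and the other is at most
   [2 |x - lam|]; also [|x (x + 1)| <= 1], so [exp |t| <= exp k]. *)
move=> lam0 k0; apply: (@cvg_power_factor _ _ _ (2 * (k ^+ 2 * expR k))) => //.
move=> x xlam; have [_ s2] := power_factor_bounds lam0 xlam.
apply: (le_trans (expR_taylor1 _)).
rewrite normrM (ger0_norm k0) exprMn -real_normK ?num_real // expr2 -!mulrA.
rewrite ler_wpM2l // [leRHS]mulrA [_ * 2]mulrC; apply: ler_pM => //.
  by rewrite !mulr_ge0 ?expR_ge0.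
rewrite !ler_wpM2l // ler_expR ler_piMl //.
by apply: le_trans s2 _; lra.
Qed.

Section noise_divergence.
Context {R : realType} {d : measure_display} {Omega : measurableType d}.
Variables (P : probability Omega R) (m : nat) (Y : 'I_m -> {RV P >-> R}).
Implicit Types u v : vec R m.

(** The integral is the total mass of the law of [u + Y], so no explicit integration is needed. *)
Lemma integral_shifted_pdf (f : R -> R) (nu : set R -> \bar R) u :
  measurable_fun [set: R] f -> (forall x, 0 <= f x) ->
  (forall A : set R, measurable A ->
    nu A = (\int[@lebesgue_measure R]_(x in A) (f x)%:E)%E) ->
  iid_with_law nu Y ->
  (\int[lebesgue_vec m]_x (shifted_pdf f u x)%:E = 1)%E.
Proof.
move=> mf f0 nuE Ynu.
have [_ _ /(_ setT measurableT) <-] := is_density_shifted_pdf mf f0 nuE Ynu u.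
by rewrite /pushforward preimage_setT probability_setT.
Qed.

Lemma gaussian_power_divergence (s2 lam : R) u v : 0 < s2 ->
  iid_with_law (gaussian s2) Y ->
  let k := norm2 (vsub u v) ^+ 2 / (2 * s2) in
  let s := lam * (lam + 1) in
  is_power_divergence lam (pushforward P (noisy Y u)) (pushforward P (noisy Y v))
    (if s == 0 then k else s^-1 * (expR (s * k) - 1))%:E.
Proof.
move=> s2_gt0 Ylaw k s.
pose sigma := Num.sqrt s2.
have sigma_neq0 : sigma != 0 by rewrite gt_eqF // sqrtr_gt0.
have sigma2E : sigma ^+ 2 = s2 by rewrite sqr_sqrtr // ltW.
pose f := normal_pdf 0 sigma.
pose q (y : R) := y ^+ 2 / (2 * s2).
have fE y : f y = normal_peak sigma * expR (- q y).
  rewrite /f normal_pdfE // /normal_fun subr0 sigma2E mulNr.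
  by rewrite -[s2 *+ 2]mulr_natl.
have c_gt0 : 0 < normal_peak sigma by exact: normal_peak_gt0.
have mf : measurable_fun [set: R] f by exact: measurable_normal_pdf.
have mq : measurable_fun [set: R] q.
  by apply: measurable_funM => //; exact: measurable_funX.
have f0 y : 0 <= f y by exact: normal_pdf_ge0.
have nuE (A : set R) : measurable A ->
  gaussian s2 A = (\int[@lebesgue_measure R]_(x in A) (f x)%:E)%E by [].
have int1 w := integral_shifted_pdf w mf f0 nuE Ylaw.
have mpdf w := @measurable_shifted_pdf _ m _ mf w.
exists (shifted_pdf f u), (shifted_pdf f v); split.
- exact: (is_density_shifted_pdf mf f0 nuE Ylaw).
- exact: (is_density_shifted_pdf mf f0 nuE Ylaw).
have pdE x : power_div x (shifted_pdf f u) (shifted_pdf f v) =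
    ((x * (x + 1))^-1 * (expR (x * (x + 1) * k) - 1))%:E.
  apply: (@power_divE _ _ _ _ (log_ratio q u v)) => //.
  - by move=> y; exact: (shifted_pdf_gt0 c_gt0 fE).
  - by move=> y; exact: (shifted_pdf_ratio fE).
  - exact: measurable_log_ratio.
  pose w : vec R m :=
    [tuple ((x + 1) * tnth u i - x * tnth v i : measurableTypeR R) | i < m].
  transitivity (\int[lebesgue_vec m]_y
      ((expR (x * (x + 1) * k))%:E * (shifted_pdf f w y)%:E))%E.
    apply: eq_integral => y _; rewrite -EFinM; congr EFin.
    (* Referring both densities to [p_v] leaves an identity between exponents, which holds
       coordinate by coordinate as a polynomial identity. *)
    rewrite (shifted_pdf_ratio fE u v y) (shifted_pdf_ratio fE w v y).
    rewrite [LHS]mulrA [RHS]mulrA -!expRD.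
    congr (expR _ * _).
    rewrite /k /norm2 sqr_sqrtr; last by apply: sumr_ge0 => i _; exact: sqr_ge0.
    rewrite /log_ratio mulr_suml !mulr_sumr -!big_split /=.
    apply: eq_bigr => i _; rewrite !tnth_mktuple /q.
    by field; rewrite gt_eqF.
  rewrite ge0_integralZl //.
  - by rewrite int1 mule1.
  - exact/measurable_EFinP.
  - by move=> y _; rewrite lee_fin ltW // (shifted_pdf_gt0 c_gt0 fE).
have -> : (lam == 0) || (lam == - 1) = (s == 0) by rewrite mulf_eq0 addr_eq0.
case: (eqVneq s 0) => [s0|_]; last by rewrite pdE.
rewrite (_ : (fun x => power_div x _ _) =
  EFin \o (fun x => (x * (x + 1))^-1 * (expR (x * (x + 1) * k) - 1))); last first.
  by apply/funext => x; rewrite pdE.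
apply: cvg_EFin; first exact: nearW.
apply: cvg_expR_power_factor => //.
by rewrite divr_ge0 ?sqr_ge0 // mulr_ge0 // ltW.
Qed.

End noise_divergence.

Section laplace_divergence.
Context {R : realType} {d : measure_display} {Omega : measurableType d}.
Variables (P : probability Omega R) (m : nat) (Y : 'I_m -> {RV P >-> R}).
Variables (b : R) (u v : vec R m).
Hypotheses (b_gt0 : 0 < b) (Ylaw : iid_with_law (laplace b) Y).

Let f := laplace_pdf b.
Let q (y : R) := `|y| / b.
Let l := log_ratio q u v.
Let a := norm1 (vsub u v) / b.

Let c_gt0 : 0 < (2 * b)^-1. Proof. by rewrite invr_gt0 mulr_gt0. Qed.

Let fE y : f y = (2 * b)^-1 * expR (- q y).
Proof. by rewrite /f /laplace_pdf mulNr. Qed.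

Let mq : measurable_fun [set: R] q.
Proof. by apply: measurable_funM => //; exact: measurable_normr. Qed.

Let mf : measurable_fun [set: R] f.
Proof.
rewrite (_ : f = fun y => (2 * b)^-1 * expR (- q y)); last exact/funext.
apply: measurable_funM => //; apply: measurableT_comp => //.
exact: measurableT_comp.
Qed.

Let f0 y : 0 <= f y. Proof. by rewrite fE mulr_ge0 ?expR_ge0 // ltW. Qed.

Let nuE (A : set R) : measurable A ->
  laplace b A = (\int[@lebesgue_measure R]_(x in A) (f x)%:E)%E.
Proof. by []. Qed.

Let p w := @shifted_pdf R f m w.

Let mp w : measurable_fun [set: vec R m] (p w).
Proof. exact: measurable_shifted_pdf. Qed.

Let p_gt0 w x : 0 < p w x.
Proof. exact: (shifted_pdf_gt0 c_gt0 fE). Qed.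

Let p_ge0 w x : 0 <= p w x. Proof. exact: ltW. Qed.

Let p_int w : (\int[lebesgue_vec m]_x (p w x)%:E = 1)%E.
Proof. exact: (integral_shifted_pdf w mf f0 nuE Ylaw). Qed.

Let pE x : p u x = expR (l x) * p v x.
Proof. exact: (shifted_pdf_ratio fE). Qed.

Let ml : measurable_fun [set: vec R m] l.
Proof. exact: measurable_log_ratio. Qed.

(** Reverse triangle inequality in each coordinate, summed and divided by [b]. *)
Let la x : `|l x| <= a.
Proof.
apply: (le_trans (ler_norm_sum _ _ _)).
rewrite /a /norm1 mulr_suml; apply: ler_sum => i _.
rewrite tnth_mktuple /q -mulrBl normrM (gtr0_norm (_ : 0 < b^-1)) ?invr_gt0 //.
rewrite ler_pM2r ?invr_gt0 // (le_trans (ler_dist_dist _ _)) //.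
by rewrite (_ : _ - _ = tnth u i - tnth v i) //; ring.
Qed.

Let a_ge0 : 0 <= a.
Proof. by rewrite divr_ge0 ?sumr_ge0 // ltW. Qed.

(* The exponent x - lam is small near lam: w is u at lam = 0 and v at lam = -1. *)
Let limit_case (lam sg : R) w : lam * (lam + 1) = 0 -> sg = 2 * lam + 1 ->
  (forall x, power_div x (p u) (p v) = ((x * (x + 1))^-1 *
     (mean (lebesgue_vec m) (p w) (fun y => expR ((x - lam) * l y)) - 1))%:E) ->
  power_div x (p u) (p v) @[x --> lam^'] -->
    (sg * mean (lebesgue_vec m) (p w) l)%:E.
Proof.
move=> lam0 sgE pdE; set K := mean _ _ l.
pose N x := mean (lebesgue_vec m) (p w) (fun y => expR ((x - lam) * l y)) - 1.
rewrite (_ : (fun x => power_div x _ _) =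
  EFin \o (fun x => (x * (x + 1))^-1 * N x)); last first.
  by apply/funext => x; rewrite pdE.
apply: cvg_EFin; first exact: nearW.
(* [a^2 exp a] bounds the Taylor remainder, [|K|] the gap between [y K] and [x (x + 1) sg K] for
   [y = x - lam], both up to the factor [y^2]. The 2 trades one [|y|] for [|x (x + 1)|]. *)
apply: (@cvg_power_factor _ _ _ (2 * (a ^+ 2 * expR a + `|K|))) => // x xlam.
have [y2 _] := power_factor_bounds lam0 xlam.
have sg2 : sg ^+ 2 = 1.
  by rewrite sgE (_ : _ ^+ 2 = 4 * (lam * (lam + 1)) + 1); [rewrite lam0; ring|ring].
set y := x - lam.
have xE : x * (x + 1) = y * (y + sg).
  by rewrite -[LHS]subr0 -lam0 /y sgE; ring.
have -> : N x - x * (x + 1) * (sg * K) =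
    (mean (lebesgue_vec m) (p w) (fun z => expR (y * l z)) - 1 - y * K)
    - y ^+ 2 * (sg * K).
  rewrite /N xE -/y (_ : y * (y + sg) * (sg * K) =
    y ^+ 2 * (sg * K) + sg ^+ 2 * (y * K)); last ring.
  by rewrite sg2; ring.
apply: (le_trans (ler_normB _ _)).
have taylor := mean_expl_taylor (mp w) (p_ge0 w) (p_int w) ml la y.
rewrite normrM (normrM sg) (_ : `|sg| = 1) ?mul1r; last first.
  by apply/eqP; rewrite -sqr_norm_eq1 sg2.
rewrite (ger0_norm (sqr_ge0 y)).
have expa : expR (`|y| * a) <= expR a.
  by rewrite ler_expR ler_piMl //; apply: le_trans xlam _; lra.
apply: (@le_trans _ _ (y ^+ 2 * (a ^+ 2 * expR a + `|K|))).
  rewrite mulrDr lerD2r (le_trans taylor) //.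
  by rewrite !ler_wpM2l // sqr_ge0.
set Z := _ + `|K|.
have Z0 : 0 <= Z by rewrite addr_ge0 // mulr_ge0 ?sqr_ge0 ?expR_ge0.
rewrite -real_normK ?num_real // (_ : _ * Z = `|y| * Z * `|y|); last ring.
rewrite [leRHS](_ : _ = `|y| * Z * (2 * `|x * (x + 1)|)); last ring.
by rewrite ler_wpM2l // mulr_ge0.
Qed.

(** The moment [c] is kept with bounds on both sides because the sign of [lam (lam + 1)] decides
    which of them controls the divergence. *)
Lemma laplace_power_divergence (lam : R) :
  let t := norm1 (vsub u v) / b in
  exists2 w : R, is_power_divergence lam (pushforward P (noisy Y u))
      (pushforward P (noisy Y v)) w%:E &
    if lam * (lam + 1) == 0 then is_true (w <= t) else
    exists2 c, expR (- (`|lam| * t)) <= c <= expR (`|lam| * t) &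
      w = (lam * (lam + 1))^-1 * (c - 1).
Proof.
rewrite -/a => t; rewrite {}/t.
have densu : is_density (pushforward P (noisy Y u)) (p u).
  exact: (is_density_shifted_pdf mf f0 nuE Ylaw).
have densv : is_density (pushforward P (noisy Y v)) (p v).
  exact: (is_density_shifted_pdf mf f0 nuE Ylaw).
have pdl x := power_div_meanl (mp u) (mp v) (p_gt0 v) pE (p_int u) (p_int v) ml la x.
have pdr x := power_div_meanr (mp u) (mp v) (p_gt0 v) pE (p_int u) (p_int v) ml la x.
have s0E : (lam == 0) || (lam == - 1) = (lam * (lam + 1) == 0).
  by rewrite mulf_eq0 addr_eq0.
have lB x : - a <= l x <= a by rewrite -ler_norml.
have KB w := mean_bounds (mp w) (p_ge0 w) (p_int w) ml lB.
have [s0|s0] := eqVneq (lam * (lam + 1)) 0; last first.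
  exists ((lam * (lam + 1))^-1 *
    (mean (lebesgue_vec m) (p u) (fun x => expR (lam * l x)) - 1)).
    by exists (p u), (p v); split => //; rewrite s0E (negbTE s0).
  exists (mean (lebesgue_vec m) (p u) (fun x => expR (lam * l x))) => //.
  exact: mean_expl_bounds.
have [lam0|lam0] : lam = 0 \/ lam = -1.
  by move/eqP: s0; rewrite -s0E => /orP[] /eqP; [left|right].
(* At 0 the limit is the Kullback-Leibler divergence of [p u] from [p v]; at -1, below, the roles
   are exchanged and [l] changes sign. *)
- exists (1 * mean (lebesgue_vec m) (p u) l).
    exists (p u), (p v); split => //; rewrite s0E s0 eqxx.
    apply: (@limit_case lam 1 u s0) => [|x]; first by rewrite lam0; ring.
    by rewrite lam0 pdl subr0.
  by rewrite mul1r; have /andP[] := KB u.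
- exists (-1 * mean (lebesgue_vec m) (p v) l).
    exists (p u), (p v); split => //; rewrite s0E s0 eqxx.
    apply: (@limit_case lam (-1) v s0) => [|x]; first by rewrite lam0; ring.
    by rewrite lam0 pdr opprK.
  by rewrite mulN1r lerNl; have /andP[] := KB v.
Qed.

End laplace_divergence.

(** * Calibration of the noise *)

Section privacy_levels.
Context {R : realType}.
Variables (lam eps Delta : R).
Hypotheses (adm : admissible lam eps) (Delta_gt0 : 0 < Delta).

Let s := lam * (lam + 1).
Let L := ln (1 + s * eps).

(** For [s < 0] the upper bound on [eps] in [admissible] is exactly this inequality. *)
Lemma admissible_arg_gt0 : 0 < 1 + s * eps.
Proof.
have [eps0 neg] := adm; have [s0|s0] := ltP s 0; last first.
  by rewrite ltr_pwDl // mulr_ge0 // ltW.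
have := neg s0; rewrite -invrN -(ltr_pM2l (_ : 0 < - s)) ?oppr_gt0 //.
by rewrite divff ?oppr_eq0 ?lt_eqF // -/s; lra.
Qed.

Lemma admissible_ln_gt0 : 0 < s -> 0 < L.
Proof.
by move=> s0; rewrite ln_gt0 // ltrDl mulr_gt0 //; case: adm.
Qed.

Lemma admissible_ln_lt0 : s < 0 -> L < 0.
Proof.
move=> s0; rewrite ln_lt0 // admissible_arg_gt0 gtrDl pmulr_llt0 //.
by case: adm.
Qed.

(** Since [exp L = 1 + s eps], the claim compares [c] with [exp L]; dividing by a negative [s]
    reverses the comparison. *)
Lemma power_level c : s != 0 ->
  (0 < s -> c <= expR L) -> (s < 0 -> expR L <= c) ->
  s^-1 * (c - 1) <= eps.
Proof.
rewrite /L lnK ?posrE ?admissible_arg_gt0 // => s0 pos neg.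
have [sneg|spos|seq] := ltgtP s 0; last by rewrite seq eqxx in s0.
  by have := neg sneg; rewrite ler_ndivrMl //; lra.
by have := pos spos; rewrite ler_pdivrMl //; lra.
Qed.

Lemma sigma2_gt0 : 0 < sigma2 lam eps Delta.
Proof.
rewrite /sigma2 -/s -/L.
have [s0|s0|s0] := ltgtP s 0; apply: mulr_gt0; rewrite ?exprn_gt0 //=.
- by rewrite nmulr_rgt0 // invr_lt0 pmulr_rlt0 // admissible_ln_lt0.
- by rewrite divr_gt0 // mulr_gt0 // admissible_ln_gt0.
- by rewrite mul1r invr_gt0 mulr_gt0 //; case: adm.
Qed.

(** [sigma2] is calibrated so that the worst case [t = Delta] gives [k = L / s], or [k = eps] if
    [s = 0], and hence divergence exactly [eps]. *)
Lemma sigma2_level (t k : R) : 0 <= t <= Delta ->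
  k = t ^+ 2 / (2 * sigma2 lam eps Delta) ->
  (if s == 0 then k else s^-1 * (expR (s * k) - 1)) <= eps.
Proof.
move=> /andP[t0 tD] kE.
have sig0 := sigma2_gt0.
have kD : k <= Delta ^+ 2 / (2 * sigma2 lam eps Delta).
  by rewrite kE ler_pM2r ?invr_gt0 ?mulr_gt0 // ler_pXn2r ?nnegrE ?(ltW Delta_gt0).
have D0 : Delta != 0 by rewrite gt_eqF.
have [s0|s0] := eqVneq s 0.
  apply: (le_trans kD); rewrite /sigma2 -/s s0 eqxx /= le_eqVlt; apply/orP; left.
  by apply/eqP; field; rewrite D0 gt_eqF //; case: adm.
have L0 : L != 0.
  have [sneg|spos|seq] := ltgtP s 0; last by rewrite seq eqxx in s0.
    by rewrite lt_eqF // admissible_ln_lt0.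
  by rewrite gt_eqF // admissible_ln_gt0.
have kL : k <= L / s.
  rewrite (_ : L / s = Delta ^+ 2 / (2 * sigma2 lam eps Delta)) //.
  by rewrite /sigma2 -/s s0 -/L; field; rewrite L0 D0 s0.
apply: power_level => // [spos|sneg]; rewrite ler_expR.
  by rewrite mulrC -ler_pdivlMr.
by rewrite mulrC -ler_ndivlMr.
Qed.

Lemma laplace_scale_bound : s != 0 ->
  `|lam| * Delta <= `|L| * laplace_scale lam eps Delta.
Proof.
move=> s0; rewrite /laplace_scale -/s s0 [s * eps + 1]addrC -/L.
set b1 := _ / L; set b2 := _ / L.
(* [L] has the sign of [lam (lam + 1)], so the signs in [b2] cancel and [b2 = |lam| Delta / |L|]. *)
apply: (@le_trans _ _ (`|L| * b2)); last by rewrite ler_wpM2l // le_max lexx orbT.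
have [sneg|spos|seq] := ltgtP s 0; last by rewrite seq eqxx in s0.
  have Lneg := admissible_ln_lt0 sneg.
  have lam1 : 0 < lam + 1 by move: sneg; rewrite /s; nra.
  have lam0 : lam < 0 by move: sneg; rewrite /s; nra.
  rewrite /b2 gtr0_sg // (ltr0_norm Lneg) (ltr0_norm lam0).
  by rewrite le_eqVlt; apply/orP; left; apply/eqP; field; rewrite lt_eqF.
have Lpos := admissible_ln_gt0 spos.
rewrite /b2 (gtr0_norm Lpos) le_eqVlt; apply/orP; left; apply/eqP.
have [lam0|lam0] := ltP lam 0.
  have lam1 : lam + 1 < 0 by move: spos; rewrite /s; nra.
  by rewrite ltr0_sg // ltr0_norm //; field; rewrite gt_eqF.
have lam1 : 0 < lam + 1 by lra.
by rewrite gtr0_sg // ger0_norm //; field; rewrite gt_eqF.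
Qed.

(** For [s != 0] the preceding bound makes [|L|] times the scale positive. *)
Lemma laplace_scale_gt0 : 0 < laplace_scale lam eps Delta.
Proof.
have [s0|s0] := eqVneq s 0.
  by rewrite /laplace_scale -/s s0 eqxx /= divr_gt0 //; case: adm.
have : 0 < `|lam| * Delta.
  by move: s0; rewrite mulf_eq0 negb_or => /andP[? _]; rewrite mulr_gt0 ?normr_gt0.
move=> /lt_le_trans /(_ (laplace_scale_bound s0)).
by apply: contraTT; rewrite -!leNgt => b0; rewrite mulr_ge0_le0.
Qed.

Lemma laplace_scale_level (t w : R) : 0 <= t <= Delta ->
  let k := t / laplace_scale lam eps Delta in
  (if s == 0 then is_true (w <= k) else
   exists2 c, expR (- (`|lam| * k)) <= c <= expR (`|lam| * k) &
     w = s^-1 * (c - 1)) -> w <= eps.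
Proof.
move=> /andP[t0 tD] k; have b0 := laplace_scale_gt0.
have kD : k <= Delta / laplace_scale lam eps Delta.
  by rewrite ler_pM2r ?invr_gt0.
have [s0|s0] := eqVneq s 0.
  move=> wk; apply: (le_trans wk); apply: (le_trans kD).
  rewrite /laplace_scale -/s s0 eqxx /= le_eqVlt; apply/orP; left; apply/eqP.
  by field; rewrite !gt_eqF //; case: adm.
case=> c /andP[c1 c2] ->.
(* This places [c] between [exp(-|L|)] and [exp |L|]; the upper end is [exp L] when [s > 0], the
   lower end when [s < 0]. *)
have kL : `|lam| * k <= `|L|.
  apply: (@le_trans _ _ (`|lam| * (Delta / laplace_scale lam eps Delta))).
    by rewrite ler_wpM2l.
  by rewrite mulrA ler_pdivrMr // laplace_scale_bound.
apply: power_level => // [spos|sneg].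
  apply: (le_trans c2); rewrite ler_expR (le_trans kL) // gtr0_norm //.
  exact: admissible_ln_gt0.
apply: le_trans c1; rewrite ler_expR lerNr (le_trans kL) // ltr0_norm //.
exact: admissible_ln_lt0.
Qed.

End privacy_levels.

(** * Sensitivity bounds and Hellinger privacy *)

Lemma le_sensitivity (R : realType) (n m : nat) (nrm : vec R m -> R)
    (DB : set (vec R n)) (W : vec R n -> vec R m) D D' :
  (0 < sensitivity nrm DB W)%E -> (sensitivity nrm DB W < +oo)%E ->
  adjacent_in DB D D' ->
  nrm (vsub (W D) (W D')) <= fine (sensitivity nrm DB W).
Proof.
move=> S0 Soo adj; rewrite -lee_fin fineK; last first.
  by rewrite ge0_fin_numE // ltW.
by apply: ereal_sup_ubound; exists (D, D').
Qed.

Lemma norm1_ge0 (R : realType) (m : nat) (v : vec R m) : 0 <= norm1 v.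
Proof. exact: sumr_ge0. Qed.

Lemma norm2_ge0 (R : realType) (m : nat) (v : vec R m) : 0 <= norm2 v.
Proof. exact: sqrtr_ge0. Qed.

(** With the Bhattacharyya coefficient [h], the integral of [sqrt(p1 p2)], the divergence at -1/2 is
    [4 (1 - h)] and the squared Hellinger distance is [2 (1 - h)]. The densities may vanish here. *)
Lemma PDP_HDP (R : realType) (d : measure_display) (Omega : measurableType d)
    (P : probability Omega R) (n m : nat) (DB : set (vec R n))
    (W : vec R n -> vec R m) (eps : R)
    (M : vec R m -> vec R n -> Omega -> vec R m) :
  PDP P DB W (- 2^-1) (2 * eps) M -> HDP P DB W eps M.
Proof.
move=> MPDP D D' adj; have [v [p1 [p2 [dens1 dens2 +]]] veps] := MPDP D D' adj.
have -> : (- 2^-1 == 0 :> R) = false by apply/eqP; lra.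
have -> : (- 2^-1 == - 1 :> R) = false by apply/eqP; lra.
move=> /= vE; move: veps; rewrite {}vE => divle.
exists p1, p2; split => //.
have [mp1 p1_ge0 int1] := dens1; have [mp2 p2_ge0 int2] := dens2.
have p1_int : (\int[lebesgue_vec m]_x (p1 x)%:E = 1)%E.
  by rewrite -int1 // /output_law /pushforward preimage_setT probability_setT.
have p2_int : (\int[lebesgue_vec m]_x (p2 x)%:E = 1)%E.
  by rewrite -int2 // /output_law /pushforward preimage_setT probability_setT.
have ip1 := integrable_pdf mp1 p1_ge0 p1_int.
have ip2 := integrable_pdf mp2 p2_ge0 p2_int.
pose g x := Num.sqrt (p1 x) * Num.sqrt (p2 x).
have sqrtM x : g x <= p1 x + p2 x.
  have := sqr_ge0 (Num.sqrt (p1 x) - Num.sqrt (p2 x)).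
  rewrite sqrrB !sqr_sqrtr // -/(g x).
  have : 0 <= g x by rewrite mulr_ge0 // sqrtr_ge0.
  by rewrite -mulr_natr; lra.
have msqrt (p : vec R m -> R) : measurable_fun [set: vec R m] p ->
    measurable_fun [set: vec R m] (fun x => Num.sqrt (p x)).
  move=> mp; apply: measurableT_comp => //.
  by apply: continuous_measurable_fun; exact: sqrt_continuous.
have mg : measurable_fun [set: vec R m] g.
  by apply: measurable_funM; exact: msqrt.
have ig : (lebesgue_vec m).-integrable setT (EFin \o g).
  apply: (@le_integrable _ _ _ _ _ measurableT _ (fun x => (p1 x)%:E + (p2 x)%:E)%E).
  - exact/measurable_EFinP.
  - move=> x _; rewrite /= lee_fin.
    rewrite (ger0_norm (_ : 0 <= g x)) ?mulr_ge0 ?sqrtr_ge0 //.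
    by rewrite (le_trans (sqrtM x)) // ler_norm.
  - exact: integrableD.
pose h := \int[lebesgue_vec m]_x g x.
have hE : (\int[lebesgue_vec m]_x (g x)%:E = h%:E)%E.
  by rewrite /h /Rintegral fineK // integrable_fin_num.
have divE : power_div (- 2^-1) p1 p2 = (- 4 * (h - 1))%:E.
  rewrite /power_div EFinM; congr (_%:E * _)%E; first by field.
  transitivity (\int[lebesgue_vec m]_x ((g x)%:E - (p2 x)%:E))%E.
    apply: eq_integral => x _; rewrite /epow.
    (* The exponent is 1/2, so [epow] never takes its infinite value. *)
    rewrite (_ : (- 2^-1 + 1 < 0 :> R) = false) ?andbF; last by apply/negbTE; lra.
    rewrite (_ : - 2^-1 + 1 = 2^-1 :> R); last by field.
    rewrite powR12_sqrt ?divr_ge0 // -EFinB -EFinM; congr EFin.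
    rewrite mulrBl mul1r; congr (_ - _); rewrite /g sqrtrM // sqrtrV //.
    (* Where [p2] vanishes both sides are 0; elsewhere [p2 / sqrt p2 = sqrt p2]. *)
    have [->|p20] := eqVneq (p2 x) 0; first by rewrite sqrtr0 !mulr0.
    rewrite -mulrA; congr (_ * _).
    rewrite -{2}(sqr_sqrtr (p2_ge0 x)) expr2 mulKf //.
    by rewrite gt_eqF // sqrtr_gt0 lt_def p20 p2_ge0.
  by rewrite integralB_EFin // hE p2_int.
have -> : (\int[lebesgue_vec m]_x
    ((Num.sqrt (p1 x) - Num.sqrt (p2 x)) ^+ 2)%:E = (2 - 2 * h)%:E)%E.
  have ig2 : (lebesgue_vec m).-integrable setT (fun x => (2%:E * (g x)%:E)%E).
    exact: integrableZl.
  transitivity (\int[lebesgue_vec m]_x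
    ((p1 x)%:E + (p2 x)%:E - 2%:E * (g x)%:E))%E.
    apply: eq_integral => x _; rewrite -[RHS]/(p1 x + p2 x - 2 * g x)%:E; congr EFin.
    by rewrite sqrrB !sqr_sqrtr // -/(g x) -mulr_natl; ring.
  rewrite integralB //; last exact: integrableD.
  rewrite integralD // p1_int p2_int integralZl // hE.
  by rewrite -[LHS]/(1 + 1 - 2 * h)%:E; congr EFin; ring.
by move: divle; rewrite divE !lee_fin; lra.
Qed.

(** * Privacy of the calibrated mechanisms and the Hellinger case *)

Theorem theorem2p2 (R : realType) (d : measure_display)
    (Omega : measurableType d) (P : probability Omega R) (n m : nat)
    (DB : set (vec R n)) (W : vec R n -> vec R m)
    (mW : measurable_query DB W)
    (D1_gt0 : (0 < sensitivity (@norm1 R m) DB W)%E)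
    (D1_fin : (sensitivity (@norm1 R m) DB W < +oo)%E)
    (D2_gt0 : (0 < sensitivity (@norm2 R m) DB W)%E)
    (D2_fin : (sensitivity (@norm2 R m) DB W < +oo)%E) :
  let Delta1 := fine (sensitivity (@norm1 R m) DB W) in
  let Delta2 := fine (sensitivity (@norm2 R m) DB W) in
  [/\ (forall lam eps : R, admissible lam eps ->
         forall Y : 'I_m -> {RV P >-> R},
           iid_with_law (gaussian (sigma2 lam eps Delta2)) Y ->
           PDP P DB W lam eps (additive_mechanism (n := n) Y)),
      (forall lam eps : R, admissible lam eps ->
         forall Y : 'I_m -> {RV P >-> R},
           iid_with_law (laplace (laplace_scale lam eps Delta1)) Y ->
           PDP P DB W lam eps (additive_mechanism (n := n) Y)) &
      (forall eps : R, admissible (- 2^-1) (2 * eps) ->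
         [/\ sigma2 (- 2^-1) (2 * eps) Delta2 = sigma2_HDP eps Delta2,
             laplace_scale (- 2^-1) (2 * eps) Delta1 =
               laplace_scale_HDP eps Delta1,
             (forall Y : 'I_m -> {RV P >-> R},
                iid_with_law (gaussian (sigma2_HDP eps Delta2)) Y ->
                HDP P DB W eps (additive_mechanism (n := n) Y)) &
             (forall Y : 'I_m -> {RV P >-> R},
                iid_with_law (laplace (laplace_scale_HDP eps Delta1)) Y ->
                HDP P DB W eps (additive_mechanism (n := n) Y))])].
Proof.
move=> Delta1 Delta2.
have Delta_gt0 (x : \bar R) : (0 < x)%E -> (x < +oo)%E -> 0 < fine x.
  by move=> x0 xoo; rewrite fine_gt0 // x0.
have D1 : 0 < Delta1 by exact: Delta_gt0.
have D2 : 0 < Delta2 by exact: Delta_gt0.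
have gauss (lam eps : R) : admissible lam eps ->
    forall Y : 'I_m -> {RV P >-> R},
      iid_with_law (gaussian (sigma2 lam eps Delta2)) Y ->
      PDP P DB W lam eps (additive_mechanism (n := n) Y).
  move=> adm Y Ylaw D D' adj.
  eexists; first exact: (gaussian_power_divergence lam (W D) (W D')
    (sigma2_gt0 adm D2) Ylaw).
  rewrite lee_fin; apply: (sigma2_level adm D2 _ erefl).
  by rewrite norm2_ge0 le_sensitivity.
have lap (lam eps : R) : admissible lam eps ->
    forall Y : 'I_m -> {RV P >-> R},
      iid_with_law (laplace (laplace_scale lam eps Delta1)) Y ->
      PDP P DB W lam eps (additive_mechanism (n := n) Y).
  move=> adm Y Ylaw D D' adj.
  have [w divE wE] := laplace_power_divergence (W D) (W D')
    (laplace_scale_gt0 adm D1) Ylaw lam.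
  exists w%:E; first exact: divE.
  rewrite lee_fin.
  apply: (laplace_scale_level adm D1 _ wE).
  by rewrite norm1_ge0 le_sensitivity.
split => // eps adm.
have sE : - 2^-1 * (- 2^-1 + 1) = - (4^-1) :> R by field.
have s0 : - (4^-1) != 0 :> R by rewrite oppr_eq0 invr_neq0.
have := admissible_arg_gt0 adm; have := admissible_ln_lt0 adm.
rewrite sE (_ : 1 + - 4^-1 * (2 * eps) = 1 - 2^-1 * eps); last by field.
set u := 1 - 2^-1 * eps => /(_ _) lnu u0.
have {}lnu : ln u < 0 by apply: lnu; rewrite oppr_lt0 invr_gt0.
(* Here [lam (lam + 1) = -1/4] and [ln u < 0]; the two minus signs cancel, which yields the positive
   constants 8 and 2. *)
have lnV : ln (1 / u) = - ln u by rewrite div1r lnV.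
have lnu0 : ln u != 0 by rewrite lt_eqF.
have sigE : sigma2 (- 2^-1) (2 * eps) Delta2 = sigma2_HDP eps Delta2.
  rewrite /sigma2 /sigma2_HDP sE s0 -/u lnV.
  rewrite (_ : 1 + - 4^-1 * (2 * eps) = u); last by rewrite /u; field.
  by field.
have lapE : laplace_scale (- 2^-1) (2 * eps) Delta1 = laplace_scale_HDP eps Delta1.
  rewrite /laplace_scale /laplace_scale_HDP sE s0 -/u lnV.
  rewrite (_ : - 4^-1 * (2 * eps) + 1 = u); last by rewrite /u; field.
  rewrite ltr0_sg ?oppr_lt0 ?invr_gt0 // gtr0_sg; last by lra.
  (* At [lam = -1/2] one has [lam + 1 = - lam], so the two entries of the maximum coincide. *)
  rewrite (_ : -1 * (- 2^-1 + 1) = 1 * - 2^-1); last by field.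
  by rewrite maxxx; field.
split=> [||Y Ylaw|Y Ylaw]; [exact: sigE|exact: lapE| |]; apply: PDP_HDP.
  by move: Ylaw; rewrite -sigE; exact: gauss adm Y.
by move: Ylaw; rewrite -lapE; exact: lap adm Y.
Qed.
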